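(* For all integers $n \geq 1$ and $k \geq 1$, the Ehrhart $h^*$-polynomial (with respect to the lattice $\tfrac12\mathbb{Z}^n$) of the half-open type C hypersimplex $\Delta'_{C_n,k}$ is \[ h^*_{\Delta'_{C_n,k}}(t) = \sum_{\substack{w \in X_n \\ \operatorname{cdes}(w^{-1}) = k}} t^{\operatorname{basc}(w)}. \]
   Context: Signed permutations: $\mathfrak{B}_n$ is the group of bijections $w$ of $[\![n]\!] := \{-n,\dots,-1,1,\dots,n\}$ with $w(-i) = -w(i)$; write $\bar i := -i$ and $w_i := w(i)$ (window notation $w = w_1\cdots w_n$). Let $X_n := \{ w \in \mathfrak{B}_n \mid w^{-1}(1) > 0\}$. Order $[\![n]\!]$ as $\bar n < \dots < \bar 1 < 1 < \dots < n$. Write $a \ll b$ if there is $c \in [\![n]\!]$ with $a < c < b$. The cyclic successor $i^+$ of $i \in [\![n]\!]$ is the next element in this order, with $n^+ := \bar n$ (so $\bar 1^+ = 1$). Big ascents: $w$ has a big ascent at $\bar 1$ iff $w_1 \geq 2$; at $i \in \{1,\dots,n-1\}$ iff $w_i \ll w_{i+1}$; at $n$ iff $w_n \leq \bar 2$. $\operatorname{basc}(w)$ is the number of big ascents. Circular descents: $i \in [\![n]\!]$ is a circular descent of $w$ if $w(i) > w(i^+)$; $\operatorname{cdes}(w)$ is the number of circular descents. Polytopes: $\Pi_{C_n} := \{x \in \mathbb{R}^n \mid 0 \le 2x_1 \le 1,\ 0 \le x_i - x_{i-1} \le 1 \ (2 \le i \le n)\}$. $\Delta'_{C_n,1} :=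 \{x \in \Pi_{C_n} \mid 0 \le 2x_n \le 1\}$ and, for $k \ge 2$, $\Delta'_{C_n,k} := \{ x \in \Pi_{C_n} \mid k-1 < 2x_n \le k\}$ (empty for $k \ge 2n$). Ehrhart theory: for $r \in \mathbb{Z}_{\ge0}$, $rP$ is the set defined by the same (weak/strict) inequalities with all right-hand and left-hand constants multiplied by $r$, and $L_P(r) := |rP \cap \tfrac12\mathbb{Z}^n|$. The $h^*$-polynomial is defined by $\sum_{r\ge0} L_P(r)t^r = h^*_P(t)/(1-t)^{n+1}$ (and is $0$ for the empty set). *)

(* Defs.v *)
From HB Require Import structures.
From mathcomp Require Import all_boot all_order all_algebra all_fingroup.
From mathcomp Require Import finmap zify.
From mathcomp Require Import boolp classical_sets cardinality reals.
Set Implicit Arguments.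
Unset Strict Implicit.
Unset Printing Implicit Defensive.
Import Order.TTheory GRing.Theory Num.Theory.
Local Open Scope ring_scope.

(* The set {-n, ..., -1, 1, ..., n}, ordered as a subset of int. *)
Record sint (n : nat) := Sint { ival : int; _ : (ival != 0) && (`|ival| <= n)%N }.

HB.instance Definition _ n := [isSub for @ival n].
HB.instance Definition _ n := [Countable of sint n by <:].

Lemma sint_code_subproof n (x : sint n) : (`|(val x + n%:Z)%R| < n + n.+1)%N.
Proof. by case: x => x /= /andP[_ ?]; lia. Qed.

Definition sint_code n (x : sint n) : 'I_(n + n.+1) :=
  Ordinal (sint_code_subproof x).

Definition sint_decode n (i : 'I_(n + n.+1)) : option (sint n) :=
  insub (i%:Z - n%:Z).

Lemma sint_codeK n : pcancel (@sint_code n) (@sint_decode n).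
Proof.
move=> x; rewrite /sint_decode /=.
suff -> : `|(val x + n%:Z)%R|%N%:Z - n%:Z = val x by rewrite valK.
by case: x => x /= /andP[_ ?]; lia.
Qed.

HB.instance Definition _ n : isFinite (sint n) :=
  PCanIsFinite (@sint_codeK n).

Lemma sint_opp_subproof n (i : sint n) :
  (- val i != 0) && (`|(- val i)%R| <= n)%N.
Proof. by case: i => i /= /andP[? ?]; lia. Qed.

Definition sint_opp n (i : sint n) : sint n := Sint (sint_opp_subproof i).

Lemma cyc_succ_subproof n (i : sint n) :
  let j := if val i == n%:Z then - n%:Z
           else if val i == -1 then 1 else val i + 1 in
  (j != 0) && (`|j| <= n)%N.
Proof.
case: i => i /= /andP[? ?]; case: (eqVneq i n%:Z) => ?; first lia.
by case: (eqVneq i (-1)) => ?; lia.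
Qed.

Definition cyc_succ n (i : sint n) : sint n := Sint (cyc_succ_subproof i).

(* [far_below a b] is the relation a << b. *)
Definition far_below n (a b : sint n) : bool :=
  [exists c : sint n, (val a < val c) && (val c < val b)].

Definition signed_perm n (w : {perm sint n}) : bool :=
  [forall i, w (sint_opp i) == sint_opp (w i)].

(* There is exactly one i with val i = 1 when n > 0. *)
Definition in_X n (w : {perm sint n}) : bool :=
  signed_perm w && [forall i, (val i == 1) ==> (0 < val ((w^-1)%g i))].

(* At i = -1, [w (sint_opp i)] is w_1; at 0 < i < n, [cyc_succ i] is i + 1. *)
Definition big_ascent n (w : {perm sint n}) (i : sint n) : bool :=
  [|| (val i == -1) && (2 <= val (w (sint_opp i))),
      [&& 0 < val i, val i < n%:Z & far_below (w i) (w (cyc_succ i))]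
    | (val i == n%:Z) && (val (w i) <= -2)].

Definition basc n (w : {perm sint n}) : nat := #|[pred i | big_ascent w i]|.

Definition cdes n (w : {perm sint n}) : nat :=
  #|[pred i | val (w (cyc_succ i)) < val (w i)]|.

(* Coordinates are indexed from 0: the mathematical x_i is [x ord0 (i - 1)].
   The argument r multiplies the constants of the defining inequalities; the
   polytope itself is r = 1. For half-open sets, r = 0 gives the solutions of
   the homogenized inequalities, not the pointwise dilate by 0. *)
Definition PiC (R : realType) (n r : nat) : set 'rV[R]_n :=
  [set x : 'rV[R]_n |
    (forall i : 'I_n, val i = 0%N ->
       0 <= x ord0 i *+ 2 /\ x ord0 i *+ 2 <= r%:R) /\
    (forall i j : 'I_n, val j = (val i).+1 ->
       0 <= x ord0 j - x ord0 i /\ x ord0 j - x ord0 i <= r%:R)]%classic.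

Definition DeltaC (R : realType) (n k r : nat) : set 'rV[R]_n :=
  [set x : 'rV[R]_n | PiC r x /\
    (forall i : 'I_n, (val i).+1 = n ->
       if k == 1%N then 0 <= x ord0 i *+ 2 /\ x ord0 i *+ 2 <= r%:R
       else (k%:R - 1) * r%:R < x ord0 i *+ 2 /\
            x ord0 i *+ 2 <= k%:R * r%:R)]%classic.

Definition half_lattice (R : realType) (n : nat) : set 'rV[R]_n :=
  [set x : 'rV[R]_n | forall i, exists z : int, x ord0 i = z%:~R / 2]%classic.

(* [P r] is the r-th dilate. [fset_set] is empty on infinite sets; the sets
   used here are finite, see [DeltaC_lattice_finite]. *)
Definition ehrhart (R : realType) (n : nat) (P : nat -> set 'rV[R]_n)
    (r : nat) : nat :=
  #|` fset_set (P r `&` @half_lattice R n)%classic|%fset.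

(* Formal power series over int are coefficient sequences. *)
Definition series_mul (a b : nat -> int) (m : nat) : int :=
  \sum_(i < m.+1) a i * b (m - i)%N.

(* sum_r L_P(r) t^r = h(t) / (1 - t)^(n+1) in Z[[t]]. *)
Definition is_hstar (R : realType) (n : nat) (P : nat -> set 'rV[R]_n)
    (h : {poly int}) : Prop :=
  forall m : nat,
    series_mul (fun i => ((1 - 'X) ^+ n.+1 : {poly int})`_i)
               (fun r => (ehrhart P r)%:Z) m = h`_m.

Lemma is_hstar_unique (R : realType) (n : nat) (P : nat -> set 'rV[R]_n)
    (h1 h2 : {poly int}) : is_hstar P h1 -> is_hstar P h2 -> h1 = h2.
Proof. by move=> H1 H2; apply/polyP => m; rewrite -H1 -H2. Qed.

Lemma DeltaC_lattice_finite (R : realType) (n k r : nat) :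
  finite_set (@DeltaC R n k r `&` @half_lattice R n)%classic.
Proof.
pose N := (n * r.*2).+1.
pose f (m : 'rV['I_N]_n) : 'rV[R]_n := \row_i ((m ord0 i)%:R / 2).
apply: (@sub_finite_set _ _ (f @` setT)%classic); last exact/finite_image/finite_finset.
move=> x [[[x0 xS] _] xL].
have xb (i : nat) (hi : (i < n)%N) : 0 <= x ord0 (Ordinal hi) *+ 2 /\
    x ord0 (Ordinal hi) *+ 2 <= (i.+1 * r.*2)%:R.
  elim: i hi => [|i IH] hi.
    have [//|a b] := x0 (Ordinal hi); split => //.
    by apply: le_trans b _; rewrite ler_nat; lia.
  have [a b] := IH (ltnW hi).
  have [//|c d] := xS (Ordinal (ltnW hi)) (Ordinal hi).
  rewrite -[x ord0 (Ordinal hi)](subrK (x ord0 (Ordinal (ltnW hi)))) mulrnDl.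
  split; first by rewrite addr_ge0 // mulrn_wge0.
  rewrite [(i.+2 * _)%N]mulSn natrD lerD //.
  by rewrite -mul2n mulnC natrM mulr_natr lerMn2r.
have /choice[g gP] i : exists m : 'I_N, x ord0 i = (m : nat)%:R / 2.
  have [z xz] := xL i; have := xb i (ltn_ord i).
  have -> : Ordinal (ltn_ord i) = i by exact: val_inj.
  have -> : x ord0 i *+ 2 = z%:~R :> R.
    by rewrite xz -[LHS]mulr_natr divfK // pnatr_eq0.
  rewrite ler0z pmulrn ler_int => -[z0 zb].
  have zN : (`|z| < N)%N.
    rewrite ltnS (@leq_trans (i.+1 * r.*2)) //; first by lia.
    by rewrite leq_mul2r ltn_ord orbT.
  by exists (Ordinal zN); rewrite xz /= -[z in LHS]gez0_abs.
exists (\row_i g i) => //; apply/rowP => i.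
by rewrite !mxE gP.
Qed.

(* Main.v *)
(* Work in the coordinates z = 2x, so that the half lattice becomes Z^n, and
   extend z to an odd function on [sint n].  The dilated polytope is cut by the
   hyperplanes z_i +- z_j = 2rm and z_i = rm into alcoves indexed by the [w] in
   X_n: subtracting from z_a the multiple 2r (offset w a), where [offset w a]
   counts the descents of w^-1 below a, leaves an odd function increasing along
   the window of [w] with values below r.  Every point of the polytope is
   attributed to the single alcove containing its displacement towards an
   interior point of the fundamental alcove 0 < z_1 < ... < z_n < r.  The walls
   of the alcove of [w] lost in this way are those separating it from the
   fundamental alcove, and they are the big ascents of [w]; moreover
   cdes(w^-1) is the ceiling of z_n / r.  Hence the alcove of [w] contains in its
   r-th dilate as many lattice points as there are solutions of
   u_0 + ... + u_n = r with u_i >= 1 at the big ascents, with generating function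
   t^(basc w) / (1 - t)^(n+1).

   To keep everything in Z, the displacement is replaced by
   (z, r) |-> (N z + a, N r + (n + 1)) with N large: no displaced point lies on a
   wall, so the alcove is the unique permutation sorting its residues modulo
   2 (N r + n + 1). *)
Require Import Defs.
From mathcomp Require Import all_boot all_order all_algebra all_fingroup.
From mathcomp Require Import finmap zify ring.
From mathcomp Require Import boolp classical_sets cardinality reals.
Set Implicit Arguments.
Unset Strict Implicit.
Unset Printing Implicit Defensive.
Import Order.TTheory GRing.Theory Num.Theory.
Local Open Scope ring_scope.

(** A nonzero [A] gives [N * A] absolute value at least [N], which [e] cannot outweigh. An
    infinitesimal displacement can therefore be replaced by an integral one. *)
Lemma sgn_lex (N A e : int) : `|e| < N ->
  (0 < N * A + e) = (0 < A) || (A == 0) && (0 < e).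
Proof.
move=> eN; case: (ltgtP A 0) => [A0|A0|->] /=; last by rewrite mulr0 add0r.
- by apply/negbTE; rewrite -leNgt; nia.
- by nia.
Qed.

(** * Signed letters and rankings *)

Section Sint.
Variable p : nat.
Local Notation n := p.+1.

Lemma sn_subproof : ((1 : int) != 0) && (`|1 : int| <= n)%N.
Proof. by []. Qed.

(* The letter k; outside of 1 <= k <= n, the junk value 1. *)
Definition sn (k : nat) : sint n := insubd (Sint sn_subproof) k%:Z.

Lemma ival_inj : injective (@ival n).
Proof. exact: val_inj. Qed.

Lemma ival_sn k : (0 < k <= n)%N -> ival (sn k) = k%:Z.
Proof.
move=> kn; rewrite -[ival _]/(val _) /sn insubdK //; rewrite unfold_in; lia.
Qed.

Lemma ival_opp (a : sint n) : ival (sint_opp a) = - ival a.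
Proof. by []. Qed.

Lemma sint_bound (a : sint n) : ival a != 0 /\ (`|ival a| <= n)%N.
Proof. by have /andP[] := valP a. Qed.

Lemma sint_oppK : involutive (@sint_opp n).
Proof. by move=> a; apply: ival_inj; rewrite !ival_opp opprK. Qed.

Lemma sn_pos (a : sint n) : 0 < ival a -> sn `|ival a| = a.
Proof.
move=> a0; have [_ an] := sint_bound a.
by apply: ival_inj; rewrite ival_sn; lia.
Qed.

Lemma sn_neg (a : sint n) : ival a < 0 -> sint_opp (sn `|ival a|) = a.
Proof.
move=> a0; have [_ an] := sint_bound a.
by apply: ival_inj; rewrite ival_opp ival_sn; lia.
Qed.

Lemma ival_cyc_succ (i : sint n) : ival (cyc_succ i) =
  if ival i == n%:Z then - n%:Z else if ival i == -1 then 1 else ival i + 1.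
Proof. by []. Qed.

Lemma cyc_succ_sn k : (0 < k < n)%N -> cyc_succ (sn k) = sn k.+1.
Proof.
move=> kn; apply: ival_inj; rewrite ival_cyc_succ !ival_sn; try lia.
by do 2?[case: ifP => ?]; lia.
Qed.

Lemma cyc_succ_max : cyc_succ (sn n) = sint_opp (sn n).
Proof.
apply: ival_inj; rewrite ival_cyc_succ ival_opp !ival_sn; try lia.
by case: ifP => ?; lia.
Qed.

Lemma cyc_succ_oppS k : (0 < k < n)%N ->
  cyc_succ (sint_opp (sn k.+1)) = sint_opp (sn k).
Proof.
move=> kn; apply: ival_inj; rewrite ival_cyc_succ !ival_opp !ival_sn; try lia.
by do 2?[case: ifP => ?]; lia.
Qed.

Lemma cyc_succ_opp1 : cyc_succ (sint_opp (sn 1)) = sn 1.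
Proof.
by apply: ival_inj; rewrite ival_cyc_succ ival_opp !ival_sn.
Qed.

Lemma big_sint (F : sint n -> nat) :
  (\sum_a F a = \sum_(1 <= k < n.+1) F (sn k) +
               \sum_(1 <= k < n.+1) F (sint_opp (sn k)))%N.
Proof.
rewrite (bigID (fun a : sint n => 0 < ival a)) /=; congr (_ + _)%N.
- rewrite big_add1 /= big_mkord.
  rewrite (reindex_onto (fun i : 'I_n => sn i.+1)
             (fun a : sint n => inord `|ival a|.-1)) /=.
    apply: eq_bigl => i; rewrite ival_sn //=; apply/eqP.
    by apply: val_inj => /=; rewrite inordK.
move=> a a0; have [_ an] := sint_bound a; rewrite inordK; last lia.
  by rewrite prednK ?sn_pos //; lia.
- rewrite big_add1 /= big_mkord.
  rewrite (reindex_onto (fun i : 'I_n => sint_opp (sn i.+1))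
             (fun a : sint n => inord `|ival a|.-1)) /=.
    apply: eq_bigl => i; rewrite ival_sn ?ltn_ord //; apply/andP; split; first by lia.
    by apply/eqP/val_inj => /=; rewrite inordK.
  move=> a a0; have [a1 an] := sint_bound a; rewrite inordK; last lia.
  by rewrite prednK ?sn_neg //; lia.
Qed.

(** Odd extension from the positive letters. Offsets and lattice points are both given this way by n
    values. *)
Definition oext (f : nat -> int) (a : sint n) : int :=
  sgz (ival a) * f `|ival a|%N.

Lemma oext_sn f k : (0 < k <= n)%N -> oext f (sn k) = f k.
Proof. by move=> kn; rewrite /oext ival_sn // gtr0_sgz ?mul1r //; lia. Qed.

Lemma oext_opp f a : oext f (sint_opp a) = - oext f a.
Proof. by rewrite /oext ival_opp sgzN abszN mulNr. Qed.

Lemma sint_mono (h : sint n -> int) :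
  (forall a b, ival a < ival b -> h a < h b) ->
  forall a b, (h a < h b) = (ival a < ival b).
Proof.
move=> hh a b; case: (ltgtP (ival a) (ival b)) => [/hh //|/hh|/ival_inj ->].
- by move=> ba; apply/negbTE; rewrite -leNgt ltW.
- by rewrite ltxx.
Qed.

Lemma odd_mono (h : sint n -> int) :
  (forall a, h (sint_opp a) = - h a) -> 0 < h (sn 1) ->
  (forall k, (0 < k < n)%N -> h (sn k) < h (sn k.+1)) ->
  forall a b, (h a < h b) = (ival a < ival b).
Proof.
move=> hN h1 hS.
have hlt j k : (0 < j < k)%N -> (k <= n)%N -> h (sn j) < h (sn k).
  elim: k => [|k IH]; first by lia.
  move=> jk kn; have [jk'|->] : ((0 < j < k)%N \/ j = k)%N by lia.
    by apply: lt_trans (IH _ _) (hS _ _); lia.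
  by apply: hS; lia.
have hp k : (0 < k <= n)%N -> 0 < h (sn k).
  move=> kn; have [->//|k1] : (k = 1 \/ 1 < k)%N by lia.
  by apply: lt_trans h1 (hlt _ _ _ _); lia.
apply: sint_mono => a b ab.
have [a0 an] := sint_bound a; have [b0 bn] := sint_bound b.
case: (ltgtP (ival a) 0) => // as0; last by lia.
- have Ha : 0 < h (sn `|ival a|) by apply: hp; lia.
  rewrite -(sn_neg as0) hN; case: (ltgtP (ival b) 0) => // bs0; last by lia.
    by rewrite -(sn_neg bs0) hN ltrN2; apply: hlt; lia.
  have := hp `|ival b|%N; rewrite (sn_pos bs0) => Hb.
  by apply: lt_trans (Hb _); [rewrite oppr_lt0|lia].
- have bs0 : 0 < ival b by lia.
  by rewrite -(sn_pos as0) -(sn_pos bs0); apply: hlt; lia.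
Qed.

(** * Permutations sorting an injective function *)

Section Rank.
Variable h : sint n -> int.
Hypothesis hI : injective h.

Definition rank (f : sint n -> int) (a : sint n) : nat := #|[pred b | f b < f a]|.

Lemma rank_lt f a b : f a < f b -> (rank f a < rank f b)%N.
Proof.
move=> ab; apply: proper_card; apply/properP; split.
  by apply/fintype.subsetP => x; rewrite !inE => /lt_trans; apply.
by exists a; rewrite !inE ?ltxx.
Qed.

Lemma rank_inj f : injective f -> injective (rank f).
Proof.
move=> fI a b ab; apply: fI; case: (ltgtP (f a) (f b)) => // /rank_lt.
- by rewrite ab ltnn.
- by rewrite ab ltnn.
Qed.

Lemma rank_bound f a : (rank f a < #|{: sint n}|)%N.
Proof.
apply: proper_card; apply/properP; split; first exact/fintype.subsetP.
by exists a; rewrite // !inE ltxx.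
Qed.

Lemma rank_sorting (w : {perm sint n}) :
  (forall a b, (h (w a) < h (w b)) = (ival a < ival b)) ->
  forall a, rank h (w a) = rank (@ival n) a.
Proof.
move=> hw a; rewrite /rank -[RHS](fintype.card_image (@perm.perm_inj _ w)).
apply: eq_card => b; rewrite inE.
by rewrite -(permKV w b) fintype.mem_image ?inE ?hw //; exact: perm.perm_inj.
Qed.

(** A sorting permutation sends each letter to the one of the same rank for [h], and ranks of an
    injective function are distinct. *)
Lemma sorting_uniq (w1 w2 : {perm sint n}) :
  (forall a b, (h (w1 a) < h (w1 b)) = (ival a < ival b)) ->
  (forall a b, (h (w2 a) < h (w2 b)) = (ival a < ival b)) -> w1 = w2.
Proof.
move=> h1 h2; apply/permP => a; apply: (rank_inj hI).
by rewrite !rank_sorting.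
Qed.

(** Ranks of an injective function biject the letters with the ordinals below their number; the
    permutation is the inverse of the ranking by [h] after the ranking by value. *)
Lemma sorting_exists : exists w : {perm sint n},
  forall a b, (h (w a) < h (w b)) = (ival a < ival b).
Proof.
pose rk (f : sint n -> int) a : 'I_#|{: sint n}| := Ordinal (rank_bound f a).
have rkI f : injective f -> injective (rk f).
  by move=> fI a b /(congr1 val)/(rank_inj fI).
have [g gK Kg] : bijective (rk h).
  by apply: inj_card_bij; rewrite ?card_ord //; exact: rkI.
have gI : injective (g \o rk (@ival n)).
  by apply: inj_comp (can_inj Kg) _; exact/rkI/ival_inj.
exists (perm gI); apply: sint_mono => a b ab.
rewrite !permE /=.
have key x : rank h (g (rk (@ival n) x)) = rank (@ival n) x.
  by have /(congr1 val) := Kg (rk (@ival n) x).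
have : (rank h (g (rk (@ival n) a)) < rank h (g (rk (@ival n) b)))%N.
  by rewrite !key; exact: rank_lt.
case: (ltgtP (h _) (h _)) => // [/rank_lt|/hI ->]; last by rewrite ltnn.
by move=> ? ?; lia.
Qed.

End Rank.
End Sint.

(* Hands [lia] the linear consequences of the nonlinear term c * A. *)
Lemma mulz_cases (c A : int) : 0 < c ->
  [\/ A = 0 /\ c * A = 0, 1 <= A /\ c <= c * A | A <= -1 /\ c * A <= - c].
Proof.
move=> c0; case: (ltgtP A 0) => [A0|A0|->].
- by apply: Or33; split; [lia|nia].
- by apply: Or32; split; [lia|nia].
- by apply: Or31; rewrite mulr0.
Qed.

Lemma big_ascent_ival n (w : {perm sint n}) i : big_ascent w i =
  [|| (ival i == -1) && (2 <= ival (w (sint_opp i))),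
      [&& 0 < ival i, ival i < n%:Z & far_below (w i) (w (cyc_succ i))]
    | (ival i == n%:Z) && (ival (w i) <= -2)].
Proof. by []. Qed.

Lemma far_belowP n (a b : sint n) :
  reflect (exists c : sint n, ival a < ival c /\ ival c < ival b) (far_below a b).
Proof.
apply: (iffP existsP) => -[c]; first by case/andP; exists c.
by move=> [ac cb]; exists c; apply/andP.
Qed.

(** * The alcove of a signed permutation *)

Section AlcoveW.
Variable p : nat.
Local Notation n := p.+1.
Local Notation sn := (@sn p).
Local Notation c := (2 * n.+1%:Z).

Variable w : {perm sint n}.
Local Notation wi := (w^-1)%g.

Definition dsc (k : nat) : bool := ival (wi (sn k.+1)) < ival (wi (sn k)).

Definition desc_upto (k : nat) : nat := (\sum_(1 <= j < k) dsc j)%N.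

Definition offset : sint n -> int := oext (fun k => (desc_upto k)%:Z).

Lemma offset1 : offset (sn 1) = 0.
Proof. by rewrite /offset oext_sn // /desc_upto big_geq. Qed.

Lemma offsetS k : (0 < k < n)%N -> offset (sn k.+1) = offset (sn k) + (dsc k)%:Z.
Proof.
move=> kn; rewrite /offset !oext_sn ?/desc_upto; try lia.
by rewrite big_nat_recr /=; lia.
Qed.

Lemma offset_opp a : offset (sint_opp a) = - offset a.
Proof. exact: oext_opp. Qed.

Lemma desc_upto_le k : (desc_upto k <= k.-1)%N.
Proof.
have -> : k.-1 = (\sum_(1 <= j < k) 1)%N by rewrite sum_nat_const_nat muln1 subn1.
by apply: leq_sum => i _; case: dsc.
Qed.

Lemma offset_bound a : `|offset a| <= p%:Z.
Proof.
rewrite /offset /oext; have [a0 an] := sint_bound a.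
have := desc_upto_le `|ival a|%N.
by case: (sgzP (ival a)) => ?; rewrite ?mul0r ?mul1r ?mulN1r; lia.
Qed.

Lemma wi_neq a b : a <> b -> ival (wi a) <> ival (wi b).
Proof. by move=> ab /ival_inj/perm.perm_inj. Qed.

Lemma sn_neq j k : (0 < j <= n)%N -> (0 < k <= n)%N -> j <> k -> sn j <> sn k.
Proof. by move=> hj hk jk /(congr1 (@ival n)); rewrite !ival_sn //; lia. Qed.

(* The affine permutation of the alcove of [w]: an interior point, with distinct
   integral coordinates, of the (n+1)-st dilate of that alcove. *)
Definition affp (a : sint n) : int := c * offset a + ival (wi a).

(** The displacement, that is, the point (1, ..., n) inside the fundamental alcove of the dilate by
    n + 1, in the coordinates of the alcove of [w]. *)
Definition shift (a : sint n) : int := ival a - c * offset a.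

(* The alcove of [w] in the dilate by [top] is cut out by the inequalities
   0 <= f(w_1) <= ... <= f(w_n) <= top between consecutive chain entries. *)
Definition chain (f : sint n -> int) (top : int) (k : nat) : int :=
  if k == 0%N then 0 else if k == n.+1 then top else f (w (sn k)).

Lemma chain0 f top : chain f top 0 = 0.
Proof. by []. Qed.

Lemma chain_mid f top k : (0 < k <= n)%N -> chain f top k = f (w (sn k)).
Proof. by move=> kn; rewrite /chain; do 2?[case: eqP => ?]; lia. Qed.

Lemma chain_top f top : chain f top n.+1 = top.
Proof. by rewrite /chain /= eqxx. Qed.

(* The index at which [big_ascent] looks at the k-th of these inequalities. *)
Definition wall (k : nat) : sint n := if k == 0%N then sint_opp (sn 1) else sn k.

(** The displacement violates the k-th inequality, so that wall separates the alcove from the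
    fundamental one. *)
Definition strict (k : nat) : bool :=
  chain shift n.+1%:Z k.+1 < chain shift n.+1%:Z k.

Hypothesis wX : in_X w.

Lemma in_X_opp a : w (sint_opp a) = sint_opp (w a).
Proof. by case/andP: wX => /forallP/(_ a)/eqP. Qed.

Lemma in_X_invopp a : wi (sint_opp a) = sint_opp (wi a).
Proof. by rewrite -{1}(permKV w a) -in_X_opp permK. Qed.

Lemma in_X_inv1 : 0 < ival (wi (sn 1)).
Proof.
case/andP: wX => _ /forallP/(_ (sn 1))/implyP; apply.
by rewrite -[X in X == _]/(ival (sn 1)) ival_sn.
Qed.

Lemma affp_opp a : affp (sint_opp a) = - affp a.
Proof. by rewrite /affp offset_opp in_X_invopp ival_opp; lia. Qed.

Lemma affp1 : affp (sn 1) = ival (wi (sn 1)).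
Proof. by rewrite /affp offset1 mulr0 add0r. Qed.

(** Values of [w^-1] differ by at most 2n < [c], and a negative difference is a descent, which the
    offset compensates by adding [c]. *)
Lemma affpS k : (0 < k < n)%N ->
  0 < affp (sn k.+1) - affp (sn k) /\ affp (sn k.+1) - affp (sn k) < c.
Proof.
move=> kn; rewrite /affp offsetS // /dsc.
have [? ?] := sint_bound (wi (sn k)); have [? ?] := sint_bound (wi (sn k.+1)).
have := @wi_neq (sn k) (sn k.+1); have := @sn_neq k k.+1.
case: ltP => ? h1 h2.
all: by have := h2 (h1 _ _ _); lia.
Qed.

Lemma affp_mono a b : (affp a < affp b) = (ival a < ival b).
Proof.
apply: odd_mono => [||k kn]; first exact: affp_opp.
  by rewrite affp1 in_X_inv1.
by have [] := affpS kn; lia.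
Qed.

Lemma affp_bounds a : [/\ (0 < affp a) = (0 < ival a),
  0 < affp (sn 1), affp (sn 1) <= n%:Z, (affp (sn 1) < affp a) = (1 < ival a)
  & (affp a < affp (sint_opp (sn 1))) = (ival a < -1)].
Proof.
have := affp_mono (sint_opp a) a; have := affp_mono (sn 1) a.
have := affp_mono a (sint_opp (sn 1)).
have := in_X_inv1; have [_ ?] := sint_bound (wi (sn 1)).
rewrite !affp_opp !ival_opp !affp1 !ival_sn // => ? ? ? ?; split => //; lia.
Qed.

(** Beyond [affpS] and its mirror image, the step from -1 to 1 has length 2 [affp (sn 1)], at most
    2n. *)
Lemma affp_cyc a : ival a < n%:Z -> affp (cyc_succ a) - affp a < c.
Proof.
move=> an; have [a0 an'] := sint_bound a.
case: (ltgtP (ival a) 0) => as0; last by lia.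
- rewrite -(sn_neg as0); case E : `|ival a|%N => [|[|k]]; first by lia.
    by rewrite cyc_succ_opp1 affp_opp affp1; have [] := sint_bound (wi (sn 1)); lia.
  rewrite cyc_succ_oppS; last lia.
  by rewrite !affp_opp; have [] := @affpS k.+1; lia.
- rewrite -(sn_pos as0) cyc_succ_sn; last lia.
  by have [] := @affpS `|ival a|%N; lia.
Qed.

(** Since [affp] takes the value [c * offset + k] at w_k, consecutive window letters a, b satisfy
    [affp b - affp a] = [c] ([offset b - offset a]) + 1. As [affp] is increasing, both a << b and
    strictness amount to [offset b - offset a] >= 1. The two end walls are compared with the letters
    1 and -1 instead. The second conjunct says that the displacement lies on no wall. *)
Lemma big_ascent_wall k : (k <= n)%N ->
  big_ascent w (wall k) = strict k /\
  chain shift n.+1%:Z k.+1 != chain shift n.+1%:Z k.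
Proof.
move=> kn; rewrite /strict /wall big_ascent_ival.
have c0 : 0 < c by lia.
have [->|k0] := eqVneq k 0%N.
  rewrite chain0 chain_mid // sint_oppK.
  set a := w (sn 1).
  have [a0 an] := sint_bound a.
  have qa : affp a = c * offset a + 1 by rewrite /affp permK ival_sn.
  have [h0 h1 h2 h3 _] := affp_bounds a.
  rewrite !ival_opp ival_sn // /shift.
  by case: (mulz_cases (offset a) c0) => -[m1 m2]; split; lia.
have [kn'|kn'] := eqVneq k n.
  rewrite kn' chain_top chain_mid ?leqnn //.
  set a := w (sn n).
  have [a0 an] := sint_bound a.
  have qa : affp a = c * offset a + n by rewrite /affp permK ival_sn; lia.
  have [h0 h1 h2 h3 h4] := affp_bounds a.
  move: h4; rewrite affp_opp => h4.
  rewrite !ival_sn /shift; try lia.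
  by case: (mulz_cases (offset a) c0) => -[m1 m2]; split; lia.
rewrite !chain_mid; try lia.
rewrite cyc_succ_sn; last lia.
set a := w (sn k); set b := w (sn k.+1).
have [a0 an] := sint_bound a; have [b0 bn] := sint_bound b.
have qa : affp a = c * offset a + k by rewrite /affp permK ival_sn; lia.
have qb : affp b = c * offset b + k.+1 by rewrite /affp permK ival_sn; lia.
have qab := affp_mono a b; have qba := affp_mono b a.
rewrite !ival_sn /shift; try lia.
have : far_below a b = (1 <= offset b - offset a).
  apply/far_belowP/idP => [[d []]|ab1].
    rewrite -!affp_mono => ad db.
    by case: (mulz_cases (offset b - offset a) c0) => -[m1 m2]; lia.
  (* One cyclic step raises [affp] by less than [c], whereas b is at least [c + 1] above a; the
     successor of a is thus strictly between them. *)
  pose d := cyc_succ a.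
  have ab : ival a < ival b.
    by case: (mulz_cases (offset b - offset a) c0) => -[m1 m2]; lia.
  have dc := affp_cyc (a := a); exists d; rewrite ival_cyc_succ.
  have [db|db] := eqVneq d b; first by move: dc; rewrite -/d db;
    case: (mulz_cases (offset b - offset a) c0) => -[m1 m2]; lia.
  have db' : ival d <> ival b by move/ival_inj/eqP; apply/negP.
  move: db'; rewrite ival_cyc_succ.
  by do 2?[case: ifP => ?]; lia.
move=> ->.
by case: (mulz_cases (offset b - offset a) c0) => -[m1 m2]; split; lia.
Qed.

(** The wall 0 is read at the letter -1 and the wall k at the letter k; other negative letters carry
    no big ascent. *)
Lemma basc_strict : basc w = (\sum_(0 <= k < n.+1) strict k)%N.
Proof.
have -> : basc w = (\sum_(a : sint n) big_ascent w a)%N.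
  rewrite /basc -sum1_card big_mkcond; apply: eq_bigr => a _.
  by rewrite inE; case: big_ascent.
rewrite big_sint [in RHS]big_nat_recl // addnC; congr (_ + _)%N.
- rewrite big_ltn // big_nat big1 => [|k kn].
    by rewrite addn0; have [<- _] := @big_ascent_wall 0 isT.
  by rewrite big_ascent_ival ival_opp ival_sn; lia.
- rewrite big_add1 /= big_nat [in RHS]big_nat; apply: eq_bigr => k kn.
  by have [<- _] := @big_ascent_wall k.+1 kn.
Qed.

(** By oddness each descent between positive letters has a mirror image. The step from -1 to 1 is
    never a descent because w^-1(1) > 0, and the step from n to -n is one exactly when w^-1(n) >
    0. *)
Lemma cdes_desc : cdes wi = (2 * desc_upto n + (0 < ival (wi (sn n)))%R)%N.
Proof.
have -> : cdes wi = (\sum_(a : sint n) (ival (wi (cyc_succ a)) < ival (wi a))%R)%N.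
  rewrite /cdes -sum1_card big_mkcond; apply: eq_bigr => a _.
  by rewrite inE; case: (_ < _).
have w1 := in_X_inv1.
rewrite big_sint /desc_upto mul2n -addnn addnAC; congr (_ + _)%N.
- rewrite big_nat_recr //= cyc_succ_max in_X_invopp ival_opp; congr (_ + _)%N.
    rewrite big_nat [in RHS]big_nat; apply: eq_bigr => k kn.
    by rewrite cyc_succ_sn.
  by congr (nat_of_bool _); lia.
- rewrite big_ltn // big_add1 /= cyc_succ_opp1 in_X_invopp ival_opp.
  have -> : (ival (wi (sn 1)) < - ival (wi (sn 1))) = false by lia.
  rewrite add0n big_nat [in RHS]big_nat; apply: eq_bigr => k kn.
  by rewrite cyc_succ_oppS // !in_X_invopp !ival_opp ltrN2.
Qed.

End AlcoveW.

(** * Half-open alcoves *)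

Section AlcovePoints.
Variable p : nat.
Local Notation n := p.+1.
Local Notation sn := (@sn p).
Local Notation c := (2 * n.+1%:Z).

(* The factor N of the displacement; any larger value would do as well. *)
Definition scale : int := c * c.

Lemma scale_big : 2 * n%:Z + 2 * (c * p%:Z) + 2 < scale.
Proof. by rewrite /scale; nia. Qed.

Lemma scale_gt : 4 * n%:Z + 4 < scale.
Proof. by rewrite /scale; nia. Qed.

Definition pert (z : sint n -> int) (a : sint n) : int := scale * z a + ival a.
Definition pertr (r : nat) : int := scale * r%:Z + n.+1%:Z.

(** The multiples [o] are left arbitrary because existence computes them before the permutation is
    known. *)
Definition reduce (o : sint n -> int) (s : int) (z : sint n -> int) (a : sint n) :=
  z a - 2 * s * o a.

(** For integral points a strict inequality is a gap of at least 1. *)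
Definition halfopen (w : {perm sint n}) (r : nat) (z : sint n -> int) :=
  forall k, (k <= n)%N ->
    (strict w k)%:Z <= chain w (reduce (offset w) r%:Z z) r%:Z k.+1
                     - chain w (reduce (offset w) r%:Z z) r%:Z k.

Lemma pertr_gt0 r : 0 < pertr r.
Proof. by rewrite /pertr; have := scale_big; nia. Qed.

Lemma pert_opp (z : sint n -> int) : (forall a, z (sint_opp a) = - z a) ->
  forall a, pert z (sint_opp a) = - pert z a.
Proof. by move=> zN a; rewrite /pert zN ival_opp; lia. Qed.

Lemma reduce_pert (w : {perm sint n}) r z a :
  reduce (offset w) (pertr r) (pert z) a =
  scale * reduce (offset w) r%:Z z a + shift w a.
Proof. by rewrite /reduce /pertr /pert /shift; lia. Qed.

Lemma shift_bound (w : {perm sint n}) (a : sint n) : `|shift w a| <= n%:Z + c * p%:Z.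
Proof.
have := offset_bound w a; have [_ ?] := sint_bound a.
by rewrite /shift; nia.
Qed.

Lemma chain_bound (w : {perm sint n}) k :
  `|chain w (shift w) n.+1%:Z k| <= n%:Z + c * p%:Z + 1.
Proof.
have := shift_bound w; rewrite /chain => h.
by do 2?[case: ifP => _]; [lia|lia|have := h (w (sn k)); lia].
Qed.

(** Each chain gap of the displaced point is [scale] times the original gap plus a nonzero gap of
    [shift], negative exactly at the strict walls; [sgn_lex] applies. *)
Lemma halfopenP (w : {perm sint n}) r (z : sint n -> int) : in_X w ->
  halfopen w r z <->
  (forall k, (k <= n)%N ->
     chain w (reduce (offset w) (pertr r) (pert z)) (pertr r) k <
     chain w (reduce (offset w) (pertr r) (pert z)) (pertr r) k.+1).
Proof.
move=> wX.
have chainE k : chain w (reduce (offset w) (pertr r) (pert z)) (pertr r) k =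
  scale * chain w (reduce (offset w) r%:Z z) r%:Z k + chain w (shift w) n.+1%:Z k.
  by rewrite /chain reduce_pert /pertr; do 2?[case: ifP => _] => //; lia.
suff H k : (k <= n)%N ->
    ((strict w k)%:Z <= chain w (reduce (offset w) r%:Z z) r%:Z k.+1
                     - chain w (reduce (offset w) r%:Z z) r%:Z k) =
    (chain w (reduce (offset w) (pertr r) (pert z)) (pertr r) k <
     chain w (reduce (offset w) (pertr r) (pert z)) (pertr r) k.+1).
  by split=> h k kn; [rewrite -H //; exact: h|rewrite H //; exact: h].
move=> kn; rewrite !chainE.
have [_] := big_ascent_wall wX kn.
have := @sgn_lex scale (chain w (reduce (offset w) r z) r k.+1 -
  chain w (reduce (offset w) r z) r k)
  (chain w (shift w) n.+1%:Z k.+1 - chain w (shift w) n.+1%:Z k).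
rewrite /strict mulrBr.
have := scale_big; have := chain_bound w k; have := chain_bound w k.+1.
by lia.
Qed.

Lemma reduce_opp o s z : (forall a, o (sint_opp a) = - o a) ->
  (forall a, z (sint_opp a) = - z a) ->
  forall a, reduce o s z (sint_opp a) = - reduce o s z a.
Proof. by move=> oN zN a; rewrite /reduce oN zN mulrN opprB; lia. Qed.

(** For an odd function the chain 0 < Y(w_1) < ... < Y(w_n) < [pertr r] says that [w] sorts it and
    that all its values are below [pertr r] in absolute value. *)
Lemma halfopen_mono (w : {perm sint n}) r (z : sint n -> int) : in_X w ->
  (forall a, z (sint_opp a) = - z a) ->
  halfopen w r z <->
  (forall a b, (reduce (offset w) (pertr r) (pert z) (w a) <
                reduce (offset w) (pertr r) (pert z) (w b)) = (ival a < ival b)) /\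
  (forall a, `|reduce (offset w) (pertr r) (pert z) a| < pertr r).
Proof.
move=> wX zN; rewrite (halfopenP _ _ wX).
have YN := reduce_opp (pertr r) (offset_opp w) (pert_opp zN).
set Y := reduce _ _ _ in YN *.
split=> [H|[H1 H2] k kn].
- have H1 a b : (Y (w a) < Y (w b)) = (ival a < ival b).
    apply: (@odd_mono _ (fun a => Y (w a))) => [d||k kn].
    + by rewrite in_X_opp // YN.
    + by have := H 0%N isT; rewrite chain0 chain_mid.
    + by have := H k; rewrite !chain_mid; try lia; apply; lia.
  split=> // a; rewrite -(permKV w a).
  have := H n (leqnn _); rewrite chain_top chain_mid ?leqnn // => Hn.
  set b := (w^-1)%g a; have [b0 bn] := sint_bound b.
  have := H1 (sn n) b; have := H1 (sn n) (sint_opp b).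
  by rewrite in_X_opp // YN ival_opp ival_sn ?leqnn //; lia.
- case: k kn => [|k] kn.
    rewrite chain0 chain_mid //.
    have := H1 (sint_opp (sn 1)) (sn 1).
    by rewrite in_X_opp // YN ival_opp ival_sn //; lia.
  have [kE|kE] := eqVneq k.+1 n.
    rewrite kE chain_top chain_mid ?leqnn //.
    by have := H2 (w (sn n)); lia.
  by rewrite !chain_mid ?H1 ?ival_sn; lia.
Qed.

(** * Position of the alcoves in the polytope and its slabs *)

Definition in_PiC (r : nat) (z : sint n -> int) : Prop :=
  (0 <= z (sn 1) /\ z (sn 1) <= r%:Z) /\
  forall k, (0 < k < n)%N ->
    0 <= z (sn k.+1) - z (sn k) /\ z (sn k.+1) - z (sn k) <= 2 * r%:Z.

Definition in_slab (k r : nat) (z : sint n -> int) : Prop :=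
  if k == 1%N then 0 <= z (sn n) /\ z (sn n) <= r%:Z
  else (k%:Z - 1) * r%:Z < z (sn n) /\ z (sn n) <= k%:Z * r%:Z.

Lemma pert_first (z : sint n -> int) r :
  (0 < pert z (sn 1) /\ pert z (sn 1) < pertr r <-> 0 <= z (sn 1) /\ z (sn 1) <= r%:Z).
Proof.
have sc := scale_gt; have s0 : 0 < scale by lia.
rewrite /pert /pertr ival_sn //.
by case: (mulz_cases (z (sn 1)) s0) => -[m1 m2];
   case: (mulz_cases (r%:Z - z (sn 1)) s0) => -[m3 m4]; lia.
Qed.

Lemma pert_diff (z : sint n -> int) r k : (0 < k < n)%N ->
  (0 < pert z (sn k.+1) - pert z (sn k) /\
   pert z (sn k.+1) - pert z (sn k) < 2 * pertr r <->
   0 <= z (sn k.+1) - z (sn k) /\ z (sn k.+1) - z (sn k) <= 2 * r%:Z).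
Proof.
move=> kn; have sc := scale_gt; have s0 : 0 < scale by lia.
rewrite /pert /pertr !ival_sn; try lia.
by case: (mulz_cases (z (sn k.+1) - z (sn k)) s0) => -[m1 m2];
   case: (mulz_cases (2 * r%:Z - (z (sn k.+1) - z (sn k))) s0) => -[m3 m4]; lia.
Qed.

(** The displacement n of the last coordinate is positive but less than (k - 1)(n + 1) as soon as k
    >= 2. The lower bound thus becomes strict for k >= 2 and stays weak for k = 1. *)
Lemma pert_slab k r z : (k <= 2 * n)%N -> 0 < pert z (sn n) ->
  (k%:Z - 1) * pertr r < pert z (sn n) -> pert z (sn n) < k%:Z * pertr r ->
  (0 < k)%N /\ in_slab k r z.
Proof.
move=> kn z0 zl zu; have r0 := pertr_gt0 r.
have k0 : (0 < k)%N by case: k kn zl zu => //; lia.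
have sc := scale_gt; have s0 : 0 < scale by lia.
have ks : k%:Z * n.+1%:Z < scale by rewrite /scale; nia.
split=> //; move: z0 zl zu; rewrite /pert /pertr ival_sn ?leqnn //.
rewrite !mulrDr !mulrBl !mul1r !(mulrCA _ scale) => z0 zl zu.
have zk : z (sn n) <= k%:Z * r%:Z.
  by case: (mulz_cases (k%:Z * r%:Z - z (sn n)) s0) => -[m1]; rewrite mulrBr; lia.
rewrite /in_slab; case: eqP => k1.
  split; last by move: zk; rewrite k1 mul1r.
  by case: (mulz_cases (z (sn n)) s0) => -[m1 m2]; lia.
split=> //; have k2 : (k%:Z - 1) * n.+1%:Z >= n.+1%:Z by nia.
case: (mulz_cases (z (sn n) - (k%:Z - 1) * r%:Z) s0) => -[m1].
all: by rewrite mulrBr mulrBl mul1r mulrBr; move: k2; rewrite mulrBl mul1r; lia.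
Qed.

Lemma in_slab_uniq j k r z : (0 < j)%N -> (0 < k)%N ->
  in_slab j r z -> in_slab k r z -> j = k.
Proof.
rewrite /in_slab => j0 k0.
by case: eqP => ?; case: eqP => ?; nia.
Qed.

(** With R = [pertr r], reduced values lie in (-R, R) and decrease from k to k + 1 exactly at a
    descent, where the offset adds 2R; displaced differences thus lie in (0, 2R). *)
Lemma halfopen_PiC (w : {perm sint n}) r (z : sint n -> int) : in_X w ->
  (forall a, z (sint_opp a) = - z a) -> halfopen w r z ->
  in_PiC r z.
Proof.
move=> wX zN /(halfopen_mono _ wX zN).
have YN := reduce_opp (pertr r) (offset_opp w) (pert_opp zN).
set Y := reduce _ _ _ in YN *; move=> [H1 H2].
have H3 a b : (Y a < Y b) = (ival ((w^-1)%g a) < ival ((w^-1)%g b)).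
  by rewrite -H1 !permKV.
split.
- apply/pert_first.
  have := H2 (sn 1); have := H3 (sint_opp (sn 1)) (sn 1); have := in_X_inv1 wX.
  rewrite YN in_X_invopp // ival_opp /Y /reduce offset1 mulr0 subr0; lia.
- move=> k kn; apply/pert_diff => //.
  have := H2 (sn k); have := H2 (sn k.+1); have := H3 (sn k.+1) (sn k).
  have := H3 (sn k) (sn k.+1).
  have : ival ((w^-1)%g (sn k)) <> ival ((w^-1)%g (sn k.+1)).
    by apply/wi_neq/sn_neq; lia.
  by rewrite /Y /reduce offsetS // /dsc; case: ltgtP => //=; lia.
Qed.

(** The displaced last coordinate is 2R [desc_upto w n] plus a residue in (-R, R) with the sign of
    w^-1(n), where R = [pertr r]. Its quotient by R rounds up to the value in [cdes_desc]. *)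
Lemma halfopen_slab (w : {perm sint n}) r (z : sint n -> int) : in_X w ->
  (forall a, z (sint_opp a) = - z a) -> halfopen w r z ->
  (0 < cdes (w^-1)%g)%N /\ in_slab (cdes (w^-1)%g) r z.
Proof.
move=> wX zN hz; have [z1 zS] := halfopen_PiC wX zN hz.
move/(halfopen_mono _ wX zN): hz.
have YN := reduce_opp (pertr r) (offset_opp w) (pert_opp zN).
set Y := reduce _ _ _ in YN *; move=> [H1 H2].
have zp k : (0 < k <= n)%N -> 0 < pert z (sn k).
  elim: k => [//|[|k] IH] kn; first by case/pert_first: z1.
  have kn' : (0 < k.+1 < n)%N by lia.
  have [+ _] := (pert_diff z r kn').2 (zS _ kn').
  by have := IH; lia.
have n0 : (0 < n <= n)%N by lia.
have := zp n n0; have := H2 (sn n).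
have := desc_upto_le w n; rewrite cdes_desc // /in_slab.
have := H1 ((w^-1)%g (sint_opp (sn n))) ((w^-1)%g (sn n)).
have := H1 ((w^-1)%g (sn n)) ((w^-1)%g (sint_opp (sn n))).
rewrite !permKV in_X_invopp // YN ival_opp.
rewrite /Y /reduce /offset oext_sn //.
have [+ _] := sint_bound ((w^-1)%g (sn n)).
move=> w0 ws' ws dn Pb Pp; apply: pert_slab => //.
- by case: (_ < _); lia.
all: move: ws' ws; rewrite PoszD PoszM; case: (ltP 0 (ival _)) => w1 ws' ws.
all: by rewrite /= ?addr0; lia.
Qed.
(** Two reductions in (-R, R), R = [pertr r], that differ by a multiple of 2R agree, so both
    permutations sort the same function. *)
Lemma halfopen_uniq (w1 w2 : {perm sint n}) r (z : sint n -> int) :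
  in_X w1 -> in_X w2 -> (forall a, z (sint_opp a) = - z a) ->
  halfopen w1 r z -> halfopen w2 r z -> w1 = w2.
Proof.
move=> X1 X2 zN /(halfopen_mono _ X1 zN) [H1 B1] /(halfopen_mono _ X2 zN) [H2 B2].
have r0 := pertr_gt0 r.
have oE a : offset w1 a = offset w2 a.
  have := B1 a; have := B2 a; rewrite /reduce.
  by case: (mulz_cases (offset w1 a - offset w2 a) r0) => -[m1]; rewrite mulrBr; lia.
apply: (@sorting_uniq _ (reduce (offset w1) (pertr r) (pert z))) => // [a b ab|a b].
  apply: (can_inj (permKV w1)); apply: ival_inj.
  have := H1 ((w1^-1)%g a) ((w1^-1)%g b); have := H1 ((w1^-1)%g b) ((w1^-1)%g a).
  by rewrite !permKV ab ltxx; lia.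
by rewrite -H2 /reduce !oE.
Qed.

Lemma eq_oext_opp (f g : sint n -> int) :
  (forall a, f (sint_opp a) = - f a) -> (forall a, g (sint_opp a) = - g a) ->
  (forall k, (0 < k <= n)%N -> f (sn k) = g (sn k)) -> f =1 g.
Proof.
move=> fN gN fg a; have [a0 an] := sint_bound a.
case: (ltgtP (ival a) 0) => as0; last by lia.
- by rewrite -(sn_neg as0) fN gN fg; lia.
- by rewrite -(sn_pos as0) fg; lia.
Qed.

(** Conjugating by negation gives another sorting permutation, hence the same one. *)
Lemma sorting_odd (h : sint n -> int) (w : {perm sint n}) : injective h ->
  (forall a, h (sint_opp a) = - h a) ->
  (forall a b, (h (w a) < h (w b)) = (ival a < ival b)) -> signed_perm w.
Proof.
move=> hI hN hw.
have wI : injective (fun a => sint_opp (w (sint_opp a))).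
  by move=> a b /(can_inj (@sint_oppK p))/perm.perm_inj/(can_inj (@sint_oppK p)).
have wE : w = perm wI.
  apply: (sorting_uniq hI hw) => a b.
  by rewrite !permE !hN ltrN2 hw !ival_opp ltrN2.
by apply/forallP => a; rewrite {1}wE permE sint_oppK.
Qed.

Lemma halfopen_exists r (z : sint n -> int) :
  (forall a, z (sint_opp a) = - z a) -> in_PiC r z ->
  exists2 w : {perm sint n}, in_X w & halfopen w r z.
Proof.
move=> zN [z1 zS]; have r0 := pertr_gt0 r.
have sc := scale_gt; have s0 : 0 < scale by lia.
have scb := scale_big.
(* Adding [pertr r] before dividing centres the residues in [-[pertr r], [pertr r]). *)
pose O := oext (fun k => divz (pert z (sn k) + pertr r) (2 * pertr r)) : sint n -> int.
have ON a : O (sint_opp a) = - O a by exact: oext_opp.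
pose Y : sint n -> int := reduce O (pertr r) (pert z).
have YN : forall a, Y (sint_opp a) = - Y a := reduce_opp (pertr r) ON (pert_opp zN).
have Ysn k : (0 < k <= n)%N -> - pertr r <= Y (sn k) /\ Y (sn k) < pertr r.
  move=> kn; rewrite /Y /reduce /O oext_sn //.
  set x := pert z (sn k) + pertr r.
  have := divz_eq x (2 * pertr r); have := @modz_ge0 x (2 * pertr r).
  have := @ltz_pmod x (2 * pertr r); rewrite /x.
  by set d := divz _ _; set m := modz _ _; lia.
have O1 : O (sn 1) = 0.
  have := Ysn 1%N isT; have [] := (pert_first z r).2 z1; rewrite /Y /reduce.
  by case: (mulz_cases (O (sn 1)) r0) => -[m1 m2]; lia.
(* Consecutive displaced coordinates differ by an amount in (0, 2 [pertr r]): the quotient grows by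
   0 or 1, and by 1 exactly when the residue drops. This is the recursion of [offset]. *)
have OS k : (0 < k < n)%N ->
    O (sn k.+1) = O (sn k) + (Y (sn k.+1) < Y (sn k))%R%:Z.
  move=> kn; have [] := (pert_diff z r kn).2 (zS k kn).
  have [] := Ysn k; first lia; have [] := Ysn k.+1; first lia.
  rewrite /Y /reduce; set A := O (sn k.+1); set B := O (sn k).
  case: (mulz_cases (A - B) r0) => -[m1]; rewrite mulrBr => m2.
  - by case: (ltP (pert z (sn k.+1) - _)) => /=; lia.
  - case: (mulz_cases (A - B - 1) r0) => -[m3]; rewrite !mulrBr mulr1 => m4.
    + by case: (ltP (pert z (sn k.+1) - _)) => /=; lia.
    + by lia.
    + by lia.
  - by lia.
have Ok k : (0 < k <= n)%N -> 0 <= O (sn k) /\ O (sn k) < k%:Z.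
  elim: k => [//|[|k] IH] kn; first by rewrite O1.
  by rewrite OS; [case: (_ < _) => /=; lia|lia].
have Ob a : `|O a| <= p%:Z.
  have [a0 an] := sint_bound a.
  case: (ltgtP (ival a) 0) => as0; last by lia.
  - by rewrite -(sn_neg as0) ON; have := Ok `|ival a|%N; lia.
  - by rewrite -(sn_pos as0); have := Ok `|ival a|%N; lia.
have cO m : `|m| <= 2 * p%:Z -> `|c * m| <= 2 * (c * p%:Z) by move=> ?; nia.
have c0 : 0 < c by lia.
(* Equal residues make a multiple of [scale] smaller than [scale], hence 0; then a - b is a multiple
   of [c], although at most 2n in absolute value. *)
have YI : injective Y.
  move=> a b; rewrite /Y /reduce /pert /pertr => ab.
  have [_ an] := sint_bound a; have [_ bn] := sint_bound b.
  have h1 := cO (O a - O b); have := Ob a; have := Ob b => hb ha.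
  have e : scale * (z a - z b - 2 * r%:Z * (O a - O b)) =
           c * (O a - O b) - (ival a - ival b) by lia.
  have e0 : c * (O a - O b) = ival a - ival b.
    by case: (mulz_cases (z a - z b - 2 * r%:Z * (O a - O b)) s0) => -[m1 m2]; lia.
  by apply: ival_inj; case: (mulz_cases (O a - O b) c0) => -[m1 m2]; lia.
(* Likewise, reaching the endpoint would make n + 1 + k a multiple of [c] = 2(n + 1). *)
have Yb k : (0 < k <= n)%N -> Y (sn k) <> - pertr r.
  move=> kn; rewrite /Y /reduce /pert /pertr ival_sn // => ab.
  have h1 := cO (O (sn k)); have hb := Ob (sn k).
  have e : scale * (z (sn k) - 2 * r%:Z * O (sn k) + r%:Z) =
           c * O (sn k) - (n.+1 + k)%:Z by lia.
  have e0 : c * O (sn k) = (n.+1 + k)%:Z.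
    by case: (mulz_cases (z (sn k) - 2 * r%:Z * O (sn k) + r%:Z) s0) => -[m1 m2]; lia.
  have k1 : 1 <= O (sn k) by case: (mulz_cases (O (sn k)) c0) => -[m1 m2]; lia.
  case: (mulz_cases (O (sn k) - 1) c0) => -[m3]; rewrite mulrBr; lia.
have [w hw] := sorting_exists YI.
have ws := sorting_odd YI YN hw.
have hwi a b : (Y a < Y b) = (ival ((w^-1)%g a) < ival ((w^-1)%g b)).
  by rewrite -hw !permKV.
have wN a : (w^-1)%g (sint_opp a) = sint_opp ((w^-1)%g a).
  by move/forallP: ws => /(_ ((w^-1)%g a))/eqP; rewrite permKV => <-; rewrite permK.
have wX : in_X w.
  apply/andP; split=> //; apply/forallP => a; apply/implyP => /eqP a1.
  have -> : a = sn 1 by apply: ival_inj; rewrite ival_sn.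
  have := hwi (sint_opp (sn 1)) (sn 1); rewrite wN YN ival_opp.
  have : 0 < Y (sn 1).
    by rewrite /Y /reduce O1; have [] := (pert_first z r).2 z1; lia.
  by rewrite -[val _]/(ival _); lia.
exists w => //; apply/(halfopen_mono _ wX zN).
have offE : offset w =1 O.
  apply: eq_oext_opp => // [a|]; first exact: offset_opp.
  elim=> [//|[|k] IH] kn; first by rewrite O1 offset1.
  have kn' : (0 < k.+1 < n)%N by lia.
  by rewrite OS // (offsetS w kn') IH /dsc ?hwi //; lia.
have YE a : reduce (offset w) (pertr r) (pert z) a = Y a by rewrite /reduce offE.
split=> [a b|a]; first by rewrite !YE.
rewrite YE; have [a0 an] := sint_bound a.
case: (ltgtP (ival a) 0) => as0; last by lia.
- have := Yb `|ival a|%N; have := Ysn `|ival a|%N.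
  have -> : Y a = - Y (sn `|ival a|%N) by rewrite -YN sn_neg.
  by lia.
- by have := Yb `|ival a|%N; have := Ysn `|ival a|%N; rewrite (sn_pos as0); lia.
Qed.

End AlcovePoints.

Lemma card_fset_set_image (T : finType) (U : choiceType) (f : T -> U)
    (P : pred T) (A : set U) : {in P &, injective f} ->
  (forall y, A y <-> exists2 t, P t & f t = y) -> #|` fset_set A|%fset = #|P|.
Proof.
move=> fI AP.
have AE : A = [set` [seq f t | t <- enum P]]%classic.
  apply/predeqP => y; rewrite AP; split=> [[t Pt <-]|/mapP[t + ->]].
    by apply/mapP; exists t; rewrite ?mem_enum.
  by rewrite mem_enum => ?; exists t.
have fA : finite_set A by rewrite AE; exact: finite_seq.
rewrite cardE -(size_map f); apply/perm_size/uniq_perm; first exact: fset_uniq.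
  rewrite map_inj_in_uniq ?enum_uniq // => x y.
  by rewrite !mem_enum => xP yP; apply: fI.
move=> y; rewrite in_fset_set //; apply/idP/idP => [/set_mem|yA]; first by rewrite AE.
by apply/mem_set; rewrite AE.
Qed.

(** * Generating functions *)

Section Composition.
Variables (q m : nat) (b : nat -> bool).

(** Bounding the parts by [m] makes the type finite and loses nothing for r <= m. *)
Definition composition (r : nat) (u : {ffun 'I_q -> 'I_m.+1}) : bool :=
  ((\sum_i u i)%N == r) && [forall i : 'I_q, (b i <= u i)%N].

Definition comp_gf : {poly int} :=
  \prod_(i < q) \sum_(j < m.+1 | (b i <= j)%N) 'X^j.

Lemma coef_comp_gf r : comp_gf`_r = #|composition r|%:Z.
Proof.
rewrite /comp_gf bigA_distr_big_dep coef_sum -sum1_card (big_morph Posz PoszD erefl).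
rewrite big_mkcond [in RHS]big_mkcond; apply: eq_bigr => u _.
rewrite (_ : (u \in family_mem _) = [forall i : 'I_q, (b i <= u i)%N]); last first.
  exact: (sameP familyP forallP).
rewrite [in RHS]unfold_in /composition; case: ifP => _; last by rewrite andbF.
have -> : \prod_(i < q) 'X^(u i) = 'X^(\sum_i u i)%N :> {poly int}.
  by rewrite (big_morph _ (exprD _) (expr0 _)).
by rewrite coefXn andbT eq_sym; case: eqP.
Qed.

Lemma mul_subX_geom (d : bool) :
  (1 - 'X) * (\sum_(j < m.+1 | (d <= j)%N) 'X^j) = 'X^d - 'X^(m.+1) :> {poly int}.
Proof.
have E : (1 - 'X) * (\sum_(j < m.+1) 'X^j) = 1 - 'X^(m.+1) :> {poly int}.
  by rewrite -opprB mulNr -subrX1 opprB.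
case: d; last by rewrite expr0 -E.
rewrite big_mkcond big_ord_recl /= add0r.
by move: E; rewrite big_ord_recl expr0 mulrDr mulr1 => /(canRL (addKr _)) ->; ring.
Qed.

(** Each factor telescopes to X^b - X^(m+1), and the truncation terms do not reach the coefficient
    of degree m. *)
Lemma coef_subX_comp_gf :
  ((1 - 'X) ^+ q * comp_gf)`_m = ('X^(\sum_(0 <= i < q) b i)%N : {poly int})`_m.
Proof.
have -> : (1 - 'X) ^+ q * comp_gf = \prod_(i < q) ('X^(b i) - 'X^(m.+1)).
  rewrite /comp_gf -[X in _ ^+ X](card_ord q) -prodr_const -big_split /=.
  by apply: eq_bigr => i _; exact: mul_subX_geom.
have [Q ->] : exists Q : {poly int},
    \prod_(i < q) ('X^(b i) - 'X^(m.+1)) = 'X^(\sum_(i < q) b i)%N + 'X^(m.+1) * Q.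
  elim: (q) => [|j [Q IH]]; first by exists 0; rewrite !big_ord0 mulr0 addr0.
  rewrite !big_ord_recr /= IH exprD.
  by exists (Q * ('X^(b j) - 'X^(m.+1)) - 'X^(\sum_(i < j) b i)%N); ring.
by rewrite coefD coefXnM ltnSn addr0 big_mkord.
Qed.

End Composition.

(** * Lattice points *)

Section Points.
Variable p : nat.
Local Notation n := p.+1.
Local Notation sn := (@sn p).
Variable m : nat.
Implicit Type u : {ffun 'I_n.+1 -> 'I_m.+1}.

Definition psum u (j : nat) : nat := (\sum_(0 <= i < j) u (inord i))%N.

Lemma psumS u j : psum u j.+1 = (psum u j + u (inord j))%N.
Proof. by rewrite /psum big_nat_recr. Qed.

Lemma psum_total u : psum u n.+1 = (\sum_i u i)%N.
Proof. by rewrite /psum big_mkord; apply: eq_bigr => i _; rewrite inord_val. Qed.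

(** The point of the alcove of [w] whose successive chain gaps are the entries of [u]. *)
Definition lpoint (r : nat) (w : {perm sint n}) u (a : sint n) : int :=
  2 * r%:Z * offset w a + oext (fun j => (psum u j)%:Z) ((w^-1)%g a).

Lemma lpoint_opp r w u : in_X w ->
  forall a, lpoint r w u (sint_opp a) = - lpoint r w u a.
Proof.
by move=> wX a; rewrite /lpoint offset_opp in_X_invopp // oext_opp; lia.
Qed.

Lemma chain_lpoint r w u k : (\sum_i u i)%N = r -> (k <= n.+1)%N ->
  chain w (reduce (offset w) r%:Z (lpoint r w u)) r%:Z k = (psum u k)%:Z.
Proof.
move=> ur kn; case: k kn => [|k] kn; first by rewrite chain0 /psum big_geq.
have [->|k1] := eqVneq k.+1 n.+1; first by rewrite chain_top psum_total ur.
by rewrite chain_mid /reduce /lpoint ?permK ?oext_sn; lia.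
Qed.

Lemma halfopen_lpoint r w u : (\sum_i u i)%N = r ->
  halfopen w r (lpoint r w u) <-> [forall i : 'I_n.+1, (strict w i <= u i)%N].
Proof.
move=> ur; split=> [H|/forallP H].
- apply/forallP => i; have := H i; rewrite -ltnS ltn_ord => /(_ isT).
  by rewrite !chain_lpoint ?psumS ?inord_val //; have := ltn_ord i; lia.
- move=> k kn; rewrite !chain_lpoint ?psumS //; last by lia.
  by have := H (inord k); rewrite inordK ?ltnS //; lia.
Qed.

Lemma lpoint_onto r w (z : sint n -> int) : (r <= m)%N -> in_X w ->
  (forall a, z (sint_opp a) = - z a) -> halfopen w r z ->
  exists u, [/\ (\sum_i u i)%N = r, lpoint r w u =1 z
              & [forall i : 'I_n.+1, (strict w i <= u i)%N]].
Proof.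
move=> rm wX zN hz.
set V := chain w (reduce (offset w) r%:Z z) r%:Z in hz.
(* Neither [inord] nor the absolute value alters a gap: the chain increases from 0 to r <= m. *)
pose u : {ffun 'I_n.+1 -> 'I_m.+1} := [ffun i : 'I_n.+1 => inord `|V i.+1 - V i|%N].
have V0 : V 0%N = 0 by [].
have Vtop : V n.+1 = r by exact: chain_top.
have VS k : (k <= n)%N -> V k <= V k.+1 by move=> kn; have := hz k kn; rewrite -/V; lia.
have Vle k d : (k + d <= n.+1)%N -> V k <= V (k + d)%N.
  elim: d => [|d IH] kd; first by rewrite addn0.
  by rewrite addnS; have := VS (k + d)%N; have := IH; lia.
have Vr k : (k <= n.+1)%N -> 0 <= V k /\ V k <= r.
  move=> kn; have := Vle 0%N k; have := Vle k (n.+1 - k)%N.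
  by rewrite add0n subnKC // Vtop V0; lia.
have uE k : (k <= n)%N -> (u (inord k) : nat)%:Z = V k.+1 - V k.
  move=> kn; have kE : (inord k : 'I_n.+1) = k :> nat by rewrite inordK.
  rewrite ffunE kE inordK; first by have := VS k; lia.
  by have := VS k; have := Vr k; have := Vr k.+1; lia.
have psumE k : (k <= n.+1)%N -> (psum u k)%:Z = V k.
  elim: k => [|k IH] kn; first by rewrite /psum big_geq.
  by rewrite psumS PoszD IH ?uE; lia.
have ur : (\sum_i u i)%N = r.
  by rewrite -psum_total; have := psumE n.+1 (leqnn _); rewrite Vtop; lia.
have uz : lpoint r w u =1 z.
  have h a : lpoint r w u (w a) = z (w a).
    move: a; apply: eq_oext_opp => [a|a|k kn].
    - by rewrite in_X_opp // lpoint_opp.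
    - by rewrite in_X_opp // zN.
    have := psumE k; rewrite /V chain_mid // /reduce /lpoint permK oext_sn //.
    by lia.
  by move=> a; rewrite -(permKV w a) h.
exists u; split=> //; apply/forallP => i.
have iN : (i <= n)%N by rewrite -ltnS ltn_ord.
by have := hz i iN; have := uE i iN; rewrite inord_val -/V; lia.
Qed.

Lemma lpoint_inj r w u1 u2 : in_X w -> (\sum_i u1 i)%N = r -> (\sum_i u2 i)%N = r ->
  lpoint r w u1 =1 lpoint r w u2 -> u1 = u2.
Proof.
move=> wX s1 s2 e.
have pE k : (k <= n.+1)%N -> psum u1 k = psum u2 k.
  move=> kn; apply/eqP; rewrite -eqz_nat -(chain_lpoint w s1) // -(chain_lpoint w s2) //.
  by rewrite /chain /reduce e.
apply/ffunP => i; apply: val_inj => /=.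
have := pE i.+1 (ltn_ord i); rewrite !psumS inord_val pE; last first.
  by have := ltn_ord i; lia.
by lia.
Qed.

(** * Bijection with the lattice points of the hypersimplex *)

Section Real.
Variable R : realType.

Definition embed (z : sint n -> int) : 'rV[R]_n := \row_i ((z (sn i.+1))%:~R / 2).

Lemma embed2 z i : embed z ord0 i *+ 2 = (z (sn i.+1))%:~R.
Proof. by rewrite mxE -[LHS]mulr_natr divfK // pnatr_eq0. Qed.

Lemma embed_inj z1 z2 : embed z1 = embed z2 ->
  (forall a, z1 (sint_opp a) = - z1 a) -> (forall a, z2 (sint_opp a) = - z2 a) ->
  z1 =1 z2.
Proof.
move=> e N1 N2; apply: eq_oext_opp => // -[//|k] kn.
have := embed2 z1 (Ordinal (kn : (k < n)%N)).
by rewrite e embed2 /= => /intr_inj.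
Qed.

Lemma half_lattice_embed (x : 'rV[R]_n) : half_lattice x ->
  exists2 z, (forall a, z (sint_opp a) = - z a) & x = embed z.
Proof.
move=> /choice[f fP]; exists (oext (fun k => f (inord k.-1))).
  exact: oext_opp.
apply/rowP => i; rewrite mxE fP oext_sn ?ltn_ord //=.
by rewrite inord_val.
Qed.

Lemma embed_half_lattice z : half_lattice (embed z).
Proof. by move=> i; exists (z (sn i.+1)); rewrite mxE. Qed.

Lemma DeltaC_embed k r z : (0 < k)%N ->
  DeltaC k r (embed z) <-> in_PiC r z /\ in_slab k r z.
Proof.
move=> k0; rewrite /DeltaC /PiC /in_PiC /in_slab /=.
have e0 (i : 'I_n) : (0 <= embed z ord0 i *+ 2) = (0 <= z (sn i.+1)).
  by rewrite embed2 ler0z.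
have e1 (i : 'I_n) : (embed z ord0 i *+ 2 <= r%:R) = (z (sn i.+1) <= r%:Z).
  by rewrite embed2 pmulrn ler_int.
have d0 (i j : 'I_n) :
    (0 <= embed z ord0 j - embed z ord0 i) = (0 <= z (sn j.+1) - z (sn i.+1)).
  by rewrite -(@pmulrn_lge0 _ _ 2) // mulrnBl !embed2 -intrB ler0z.
have d1 (i j : 'I_n) : (embed z ord0 j - embed z ord0 i <= r%:R) =
    (z (sn j.+1) - z (sn i.+1) <= 2 * r%:Z).
  rewrite -(@ler_pMn2r _ 2) // mulrnBl !embed2 -intrB -mulrnA mulnC pmulrn.
  by rewrite ler_int PoszM.
have s0 (i : 'I_n) : ((k%:R - 1) * r%:R < embed z ord0 i *+ 2) =
    ((k%:Z - 1) * r%:Z < z (sn i.+1)).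
  by rewrite embed2 !pmulrn -[1]/(1%:~R) -intrB -intrM ltr_int.
have s1 (i : 'I_n) : (embed z ord0 i *+ 2 <= k%:R * r%:R) =
    (z (sn i.+1) <= k%:Z * r%:Z).
  by rewrite embed2 !pmulrn -intrM ler_int.
split=> [[[H1 H2] H3]|[[H1 H2] H3]].
- split; [split=> [|j jn]|].
  + by have := H1 ord0 erefl; rewrite e0 e1.
  + have jn1 : (j.-1 < n)%N by lia.
    have jn2 : (j < n)%N by lia.
    have := H2 (Ordinal jn1) (Ordinal jn2); rewrite d0 d1 /= prednK; last by lia.
    by apply; lia.
  + by have := H3 ord_max erefl; rewrite e0 e1 s0 s1.
- split; [split=> [i i0|i j ij]|].
  + by rewrite e0 e1 i0.
  + rewrite d0 d1 ij; apply: H2.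
    by have := ltn_ord j; rewrite ij; lia.
  + by move=> i iN; rewrite e0 e1 s0 s1 iN.
Qed.

Definition lattice_code (k r : nat) (t : {perm sint n} * {ffun 'I_n.+1 -> 'I_m.+1}) :=
  [&& in_X t.1, cdes (t.1^-1)%g == k & composition (strict t.1) r t.2].

(** Each lattice point lies in exactly one half-open alcove, whose slab is given by [cdes], and is
    determined there by its gaps. *)
Lemma card_DeltaC k r : (0 < k)%N -> (r <= m)%N ->
  ehrhart (@DeltaC R n k) r = #|lattice_code k r|.
Proof.
move=> k0 rm; rewrite /ehrhart.
apply: (@card_fset_set_image _ _ (fun t => embed (lpoint r t.1 t.2))).
- move=> [w1 u1] [w2 u2]; rewrite !unfold_in /=.
  move=> /and3P[/= X1 _ /andP[/eqP s1 h1]] /and3P[/= X2 _ /andP[/eqP s2 h2]].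
  move/embed_inj => /(_ (lpoint_opp r u1 X1) (lpoint_opp r u2 X2)) e.
  have H1 := (halfopen_lpoint w1 s1).2 h1; have H2 := (halfopen_lpoint w2 s2).2 h2.
  have w12 : w1 = w2.
    apply: (halfopen_uniq X1 X2 (lpoint_opp r u1 X1) H1).
    by rewrite (_ : lpoint r w1 u1 = lpoint r w2 u2) //; apply/funext.
  by subst w2; rewrite (lpoint_inj X1 s1 s2 e).
- move=> y; split=> [[yD /half_lattice_embed[z zN yE]]|[[w u]]].
  + move: yD; rewrite yE => /(DeltaC_embed _ _ k0)[zP zk].
    have [w wX hz] := halfopen_exists zN zP.
    have [u [us uz uh]] := lpoint_onto rm wX zN hz.
    have [w0 wk] := halfopen_slab wX zN hz.
    exists (w, u); last by congr embed; apply/funext.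
    rewrite /lattice_code /composition wX us uh eqxx /= !andbT.
    by apply/eqP/(in_slab_uniq w0 k0 wk zk).
  + move=> /and3P[/= X1 /eqP ck /andP[/eqP s1 h1]] <-.
    have zN := lpoint_opp r u X1; have hz := (halfopen_lpoint w s1).2 h1.
    split; last exact: embed_half_lattice.
    apply/DeltaC_embed => //; split; first exact: halfopen_PiC hz.
    by have [_] := halfopen_slab X1 zN hz; rewrite ck.
Qed.

Lemma ehrhart_coef k r : (0 < k)%N -> (r <= m)%N ->
  (ehrhart (@DeltaC R n k) r)%:Z =
  (\sum_(w : {perm sint n} | in_X w && (cdes (w^-1)%g == k))
     comp_gf n.+1 m (strict w))`_r.
Proof.
move=> k0 rm; rewrite card_DeltaC // coef_sum.
under eq_bigr do rewrite coef_comp_gf.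
rewrite -(big_morph Posz PoszD erefl) -sum1_card; congr Posz.
under [RHS]eq_bigr do rewrite -sum1_card.
by rewrite pair_big_dep; apply: eq_bigl => t; rewrite !unfold_in /lattice_code -andbA.
Qed.

End Real.
End Points.

Theorem theoremA (R : realType) (n k : nat) (hn : (1 <= n)%N) (hk : (1 <= k)%N) :
  is_hstar (@DeltaC R n k)
    (\sum_(w : {perm sint n} | in_X w && (cdes (w^-1)%g == k)) 'X^(basc w)).
Proof.
case: n hn => [//|p] _ m; set H := (\sum_(w | _) _).
(* Truncating at the degree [m] under inspection suffices, since only dilates r <= m enter that
   coefficient. *)
pose G : {poly int} := \sum_(w : {perm sint p.+1} | in_X w && (cdes (w^-1)%g == k))
  comp_gf p.+2 m (strict w).
have -> : series_mul (fun i => ((1 - 'X) ^+ p.+2 : {poly int})`_i)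
    (fun r => (ehrhart (@DeltaC R p.+1 k) r)%:Z) m = ((1 - 'X) ^+ p.+2 * G)`_m.
  rewrite coefM; apply: eq_bigr => i _.
  by rewrite (@ehrhart_coef _ m) // leq_subr.
rewrite /G /H mulr_sumr !coef_sum; apply: eq_bigr => w /andP[wX _].
by rewrite coef_subX_comp_gf basc_strict.
Qed.
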